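(* The calculus RT is cut-free complete for reflexive models: for every hypersequent $H$, if no model based on a reflexive frame is a counter-example to $H$, then $H$ has a derivation in RT that does not use the Cut rule.
   Context: **Language.** Modal formulas are built from propositional variables by $\lnot,\land,\Box$. A frame is $\langle W,R\rangle$ with $W\neq\emptyset$, $R\subseteq W\times W$; a model $\mathfrak M=\langle W,R,V\rangle$ adds a valuation, and truth $\mathfrak M,w\models\varphi$ is the usual Kripke truth definition ($\Box\varphi$ is true at $w$ iff $\varphi$ is true at every $v$ with $wRv$). **Hypersequents.** A sequent is an expression $\Gamma\Rightarrow\Delta$ with $\Gamma,\Delta$ finite sets of formulas (written as comma-separated lists; $\varphi,\Gamma$ means $\{\varphi\}\cup\Gamma$, and $\varphi\in\Gamma$ is allowed). A hypersequent is a finite nonempty sequence of sequents $S_1\;/\!/\;\dots\;/\!/\; S_n$ (order and multiplicity matter). **Semantics.** $\mathfrak M$ is a countermodel to $\Gamma\Rightarrow\Delta$ at $w$ iff $\mathfrak M,w\models\varphi$ for all $\varphi\in\Gamma$ and $\mathfrak M,w\not\models\psi$ for all $\psi\in\Delta$. $\mathfrak M$ is a counter-example to $\Gamma_1\Rightarrow\Delta_1\;/\!/\;\dots\;/\!/\;\Gamma_n\Rightarrow\Delta_n$ iff there are worlds $w_1,\dots,w_n$ with $w_iRw_{i+1}$ for $1\le i<n$ such that $\mathfrak M$ is a countermodel to $\Gamma_i\Rightarrow\Delta_i$ at $w_i$ for every $i$. **The calculus RK.** Derivations are finite trees of hypersequents whose leaves are axioms $\varphi\Rightarrow\varphi$ (one-component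 hypersequents) and which are built by the following rules. Here $G,H$ are possibly empty sequences of sequents unless otherwise said; ''premise(s) / conclusion''. - WL: $G\;/\!/\;\Gamma\Rightarrow\Delta\;/\!/\; H$ / $G\;/\!/\;\varphi,\Gamma\Rightarrow\Delta\;/\!/\; H$. - WR: $G\;/\!/\;\Gamma\Rightarrow\Delta\;/\!/\; H$ / $G\;/\!/\;\Gamma\Rightarrow\Delta,\varphi\;/\!/\; H$. - Cut: $G\;/\!/\;\Gamma\Rightarrow\Delta,\varphi\;/\!/\; H$ and $G\;/\!/\;\varphi,\Lambda\Rightarrow\Theta\;/\!/\; H$ / $G\;/\!/\;\Gamma,\Lambda\Rightarrow\Delta,\Theta\;/\!/\; H$. - EWR: $G$ / $G\;/\!/\;\ \Rightarrow\ $ ($G$ a hypersequent; an empty sequent is appended on the right). - EWL: $G$ / $\ \Rightarrow\ \;/\!/\; G$ ($G$ a hypersequent; an empty sequent is prepended on the left). - $\lnot$L: $G\;/\!/\;\Gamma\Rightarrow\Delta,\varphi\;/\!/\; H$ / $G\;/\!/\;\lnot\varphi,\Gamma\Rightarrow\Delta\;/\!/\; H$. - $\lnot$R: $G\;/\!/\;\varphi,\Gamma\Rightarrow\Delta\;/\!/\; H$ / $G\;/\!/\;\Gamma\Rightarrow\Delta,\lnot\varphi\;/\!/\; H$. - $\land$L$_1$: $G\;/\!/\;\varphi,\Gamma\Rightarrow\Delta\;/\!/\; H$ / $G\;/\!/\;\varphi\land\psi,\Gamma\Rightarrow\Delta\;/\!/\; H$. - $\land$L$_2$: $G\;/\!/\;\psi,\Gamma\Rightarrow\Delta\;/\!/\;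 H$ / $G\;/\!/\;\varphi\land\psi,\Gamma\Rightarrow\Delta\;/\!/\; H$. - $\land$R: $G\;/\!/\;\Gamma\Rightarrow\Delta,\varphi\;/\!/\; H$ and $G\;/\!/\;\Gamma\Rightarrow\Delta,\psi\;/\!/\; H$ / $G\;/\!/\;\Gamma\Rightarrow\Delta,\varphi\land\psi\;/\!/\; H$. - $\Box$L: $G\;/\!/\;\Gamma\Rightarrow\Delta\;/\!/\;\varphi,\Lambda\Rightarrow\Theta\;/\!/\; H$ / $G\;/\!/\;\Box\varphi,\Gamma\Rightarrow\Delta\;/\!/\;\Lambda\Rightarrow\Theta\;/\!/\; H$. - $\Box$R: $H\;/\!/\;\Gamma\Rightarrow\Delta\;/\!/\;\ \Rightarrow\varphi$ / $H\;/\!/\;\Gamma\Rightarrow\Delta,\Box\varphi$ (the active components are rightmost). **The calculus RT** is RK together with external contraction EC: $G\;/\!/\;\Gamma\Rightarrow\Delta\;/\!/\;\Gamma\Rightarrow\Delta\;/\!/\; H$ / $G\;/\!/\;\Gamma\Rightarrow\Delta\;/\!/\; H$. *)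

(* Defs.v *)
From HB Require Import structures.
From mathcomp Require Import all_boot.
From mathcomp Require Import finmap.

Set Implicit Arguments.
Unset Strict Implicit.
Unset Printing Implicit Defensive.

Local Open Scope fset_scope.

Inductive form : Type :=
| Var of nat
| Neg of form
| And of form & form
| Box of form.

(* Finite sets {fset form} require a choiceType on formulas; it is transported
   from finitely branching trees. *)
Fixpoint form_to_tree (f : form) : GenTree.tree nat :=
  match f with
  | Var n => GenTree.Leaf n
  | Neg f => GenTree.Node 0 [:: form_to_tree f]
  | And f g => GenTree.Node 1 [:: form_to_tree f; form_to_tree g]
  | Box f => GenTree.Node 2 [:: form_to_tree f]
  end.

Fixpoint tree_to_form (t : GenTree.tree nat) : form :=
  match t with
  | GenTree.Leaf n => Var n
  | GenTree.Node 0 [:: t] => Neg (tree_to_form t)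
  | GenTree.Node 1 [:: t; u] => And (tree_to_form t) (tree_to_form u)
  | GenTree.Node 2 [:: t] => Box (tree_to_form t)
  | _ => Var 0
  end.

Lemma form_to_treeK : cancel form_to_tree tree_to_form.
Proof. by elim=> //= [f ->|f -> g ->|f ->]. Qed.

HB.instance Definition _ := Countable.copy form (can_type form_to_treeK).

Record frame := Frame {
  world :> Type;
  acc : world -> world -> Prop;
  world_inhabited : inhabited world
}.

Definition reflexive_frame (F : frame) : Prop := forall w : F, acc w w.

Record model := Model {
  model_frame :> frame;
  valuation : nat -> model_frame -> Prop
}.

Fixpoint truth (M : model) (w : M) (f : form) : Prop :=
  match f with
  | Var n => valuation n w
  | Neg f => ~ truth w f
  | And f g => truth w f /\ truth w g
  | Box f => forall v : M, acc w v -> truth v f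
  end.

Record sequent := Sequent { ante : {fset form}; succ : {fset form} }.

Notation "Gamma '⇒' Delta" := (Sequent Gamma Delta)
  (at level 65, no associativity).

(* Components in order.  A hypersequent proper is a nonempty such sequence;
   the contexts G, H of the rules may be empty. *)
Definition hypersequent := seq sequent.

Definition countermodel (M : model) (w : M) (S : sequent) : Prop :=
  (forall f, f \in ante S -> truth w f) /\
  (forall f, f \in succ S -> ~ truth w f).

Definition counterexample (M : model) (H : hypersequent) : Prop :=
  exists w : 'I_(size H) -> M,
    (forall i j : 'I_(size H), j = i.+1 :> nat -> acc (w i) (w j)) /\
    (forall i : 'I_(size H), countermodel (w i) (tnth (in_tuple H) i)).

(* Derivation trees of RK extended by a set of one-premise rules:
   ext P C says that P / C is an instance of an additional rule.
   Since Gamma, Delta are sets, the principal formula may also belong to the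
   context.  EW_R and EW_L need no nonemptiness condition on G: only nonempty
   sequences are derivable in RK and RT. *)
Inductive derivation (ext : hypersequent -> hypersequent -> Prop) :
  hypersequent -> Type :=
| Ax (f : form) :
    derivation ext [:: [fset f] ⇒ [fset f]]
| W_L G H (Gamma Delta : {fset form}) (f : form) :
    derivation ext (G ++ (Gamma ⇒ Delta) :: H) ->
    derivation ext (G ++ (f |` Gamma ⇒ Delta) :: H)
| W_R G H (Gamma Delta : {fset form}) (f : form) :
    derivation ext (G ++ (Gamma ⇒ Delta) :: H) ->
    derivation ext (G ++ (Gamma ⇒ f |` Delta) :: H)
| Cut G H (Gamma Delta Lambda Theta : {fset form}) (f : form) :
    derivation ext (G ++ (Gamma ⇒ f |` Delta) :: H) ->
    derivation ext (G ++ (f |` Lambda ⇒ Theta) :: H) ->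
    derivation ext (G ++ (Gamma `|` Lambda ⇒ Delta `|` Theta) :: H)
| EW_R G :
    derivation ext G -> derivation ext (G ++ [:: fset0 ⇒ fset0])
| EW_L G :
    derivation ext G -> derivation ext ((fset0 ⇒ fset0) :: G)
| Neg_L G H (Gamma Delta : {fset form}) (f : form) :
    derivation ext (G ++ (Gamma ⇒ f |` Delta) :: H) ->
    derivation ext (G ++ (Neg f |` Gamma ⇒ Delta) :: H)
| Neg_R G H (Gamma Delta : {fset form}) (f : form) :
    derivation ext (G ++ (f |` Gamma ⇒ Delta) :: H) ->
    derivation ext (G ++ (Gamma ⇒ Neg f |` Delta) :: H)
| And_L1 G H (Gamma Delta : {fset form}) (f g : form) :
    derivation ext (G ++ (f |` Gamma ⇒ Delta) :: H) ->
    derivation ext (G ++ (And f g |` Gamma ⇒ Delta) :: H)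
| And_L2 G H (Gamma Delta : {fset form}) (f g : form) :
    derivation ext (G ++ (g |` Gamma ⇒ Delta) :: H) ->
    derivation ext (G ++ (And f g |` Gamma ⇒ Delta) :: H)
| And_R G H (Gamma Delta : {fset form}) (f g : form) :
    derivation ext (G ++ (Gamma ⇒ f |` Delta) :: H) ->
    derivation ext (G ++ (Gamma ⇒ g |` Delta) :: H) ->
    derivation ext (G ++ (Gamma ⇒ And f g |` Delta) :: H)
| Box_L G H (Gamma Delta Lambda Theta : {fset form}) (f : form) :
    derivation ext (G ++ [:: Gamma ⇒ Delta, f |` Lambda ⇒ Theta & H]) ->
    derivation ext (G ++ [:: Box f |` Gamma ⇒ Delta, Lambda ⇒ Theta & H])
| Box_R H (Gamma Delta : {fset form}) (f : form) :
    derivation ext (H ++ [:: Gamma ⇒ Delta; fset0 ⇒ [fset f]]) ->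
    derivation ext (H ++ [:: Gamma ⇒ Box f |` Delta])
| Ext P C :
    ext P C -> derivation ext P -> derivation ext C.

Fixpoint cut_free (ext : hypersequent -> hypersequent -> Prop)
  (H : hypersequent) (d : derivation ext H) {struct d} : Prop :=
  match d with
  | Ax _ => True
  | Cut _ _ _ _ _ _ _ _ _ => False
  | W_L _ _ _ _ _ d | W_R _ _ _ _ _ d
  | EW_R _ d | EW_L _ d
  | Neg_L _ _ _ _ _ d | Neg_R _ _ _ _ _ d
  | And_L1 _ _ _ _ _ _ d | And_L2 _ _ _ _ _ _ d
  | Box_L _ _ _ _ _ _ _ d | Box_R _ _ _ _ d
  | Ext _ _ _ d => cut_free d
  | And_R _ _ _ _ _ _ d e => cut_free d /\ cut_free e
  end.

Inductive EC : hypersequent -> hypersequent -> Prop :=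
| EC_rule G H (Gamma Delta : {fset form}) :
    EC (G ++ [:: Gamma ⇒ Delta, Gamma ⇒ Delta & H])
       (G ++ (Gamma ⇒ Delta) :: H).

Definition RK : hypersequent -> Type := derivation (fun _ _ => False).
Definition RT : hypersequent -> Type := derivation EC.

(* Main.v *)
From Stdlib Require Import Classical.
Require Import Defs.
From mathcomp Require Import all_boot.
From mathcomp Require Import finmap.

(** Worlds of the countermodel are the hypersequents [rcons G S] that have no
cut-free derivation and whose last component [S] is saturated; a world sees
another one when the unboxed antecedent of its last component is included in
the antecedent of the other's.

Closing a component under reflexivity (from [Box f] on the left to [f] on the
left) goes through EC: [G // S // H] is replaced by [G // S // f,S // H], where
the old copy of [S] joins the prefix.  The new copy contains the old one, so it
still contains everything pushed into it from the left, and the old copies can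
be ignored when the countermodel is read off. *)

Set Implicit Arguments.
Unset Strict Implicit.
Unset Printing Implicit Defensive.

Local Open Scope fset_scope.

(** Each rule treats one formula at a time; listing [Y \ X] turns such single steps into a passage
    from [X] to [Y]. *)
Lemma fset_grow_ind (T : choiceType) (P : {fset T} -> Prop) (X Y : {fset T}) :
  X `<=` Y ->
  (forall x Z, x \in Y -> x \notin X -> P Z -> P (x |` Z)) -> P X -> P Y.
Proof.
move=> sXY step PX.
have grow (s : seq T) : {subset s <= Y `\` X} -> P (seq_fset tt s `|` X).
  elim: s => [|x s IHs] ss.
    suff -> : seq_fset tt [::] `|` X = X by [].
    by apply/fsetP=> y; rewrite inE seq_fsetE.
  have -> : seq_fset tt (x :: s) `|` X = x |` (seq_fset tt s `|` X).
    by apply/fsetP=> y; rewrite !inE !seq_fsetE inE orbA.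
  have := ss x (mem_head _ _); rewrite inE => /andP[xX xY].
  by apply: step => //; apply: IHs => y ys; apply: ss; rewrite inE ys orbT.
have /grow : {subset (Y `\` X : seq T) <= Y `\` X} by [].
suff -> : seq_fset tt (Y `\` X) `|` X = Y by [].
apply/fsetP=> y; rewrite !inE seq_fsetE inE.
by case: (boolP (y \in X)) => //= [/(fsubsetP sXY)->|_]; rewrite ?orbF.
Qed.

(** * Cut-free derivability and weakening *)

Definition sub_sequent (S T : sequent) : Prop :=
  ante S `<=` ante T /\ succ S `<=` succ T.

Lemma sub_sequent_trans S T U :
  sub_sequent S T -> sub_sequent T U -> sub_sequent S U.
Proof. by move=> [a s] [/(fsubset_trans a) ? /(fsubset_trans s) ?]. Qed.

Definition derivable (H : hypersequent) : Prop :=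
  exists d : RT H, cut_free d.

Lemma derivable_weak G H S T :
  sub_sequent S T -> derivable (G ++ S :: H) -> derivable (G ++ T :: H).
Proof.
case: S T => [A B] [A' B'] [/= sA sB] dS.
have dL : derivable (G ++ (A' ⇒ B) :: H).
  apply: (fset_grow_ind (P := fun Z => derivable (G ++ (Z ⇒ B) :: H))) sA _ dS.
  by move=> f Z _ _ [d cd]; exists (W_L f d).
apply: (fset_grow_ind (P := fun Z => derivable (G ++ (A' ⇒ Z) :: H))) sB _ dL.
by move=> f Z _ _ [d cd]; exists (W_R f d).
Qed.

Lemma derivable_cat_r G H : derivable G -> derivable (G ++ H).
Proof.
move=> dG; elim/last_ind: H => [|H S [d cd]]; first by rewrite cats0.
rewrite -cats1 catA.
apply: (@derivable_weak _ [::] (fset0 ⇒ fset0)); first by split; exact: fsub0set.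
by exists (EW_R d).
Qed.

Lemma derivable_cat_l G H : derivable H -> derivable (G ++ H).
Proof.
move=> dH; elim: G => [|S G [d cd]] //=.
apply: (@derivable_weak [::] _ (fset0 ⇒ fset0)); first by split; exact: fsub0set.
by exists (EW_L d).
Qed.

Lemma derivable_ax G H S f :
  f \in ante S -> f \in succ S -> derivable (G ++ S :: H).
Proof.
move=> fa fs; apply: (@derivable_weak _ _ ([fset f] ⇒ [fset f])).
  by split; rewrite fsub1set.
by apply/derivable_cat_l/(@derivable_cat_r [:: _]); exists (Ax _ f).
Qed.

Lemma underivable_init G S H :
  ~ derivable (G ++ S :: H) -> ~ derivable (rcons G S).
Proof. by move=> nd d; apply: nd; rewrite -cat_rcons; apply: derivable_cat_r. Qed.

(** * Saturation *)

Record saturated (S : sequent) : Prop := Saturated {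
  sat_negl : forall f, Neg f \in ante S -> f \in succ S;
  sat_negr : forall f, Neg f \in succ S -> f \in ante S;
  sat_andl : forall f g, And f g \in ante S -> f \in ante S /\ g \in ante S;
  sat_andr : forall f g, And f g \in succ S -> f \in succ S \/ g \in succ S;
  sat_boxl : forall f, Box f \in ante S -> f \in ante S
}.

Definition subformula_closed (U : {fset form}) : Prop :=
  forall f, f \in U ->
  match f with
  | Var _ => true
  | Neg f | Box f => f \in U
  | And f g => (f \in U) && (g \in U)
  end.

Lemma subformula_closedU U V :
  subformula_closed U -> subformula_closed V -> subformula_closed (U `|` V).
Proof.
move=> cU cV f; rewrite inE => /orP[/cU|/cV];
  case: f => //= [f|f g|f]; rewrite !inE; try by move->; rewrite ?orbT.
all: by case/andP=> -> ->; rewrite ?orbT.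
Qed.

Lemma subformula_closed1 f :
  exists2 U, subformula_closed U & f \in U.
Proof.
have top (g : form) U : subformula_closed U ->
    match g with
    | Var _ => true | Neg f | Box f => f \in U
    | And f g => (f \in U) && (g \in U)
    end -> exists2 V, subformula_closed V & g \in V.
  move=> cU gU; exists (g |` U); last by rewrite fset1U1.
  have up x : x \in U -> x \in g |` U by move=> xU; rewrite inE xU orbT.
  move=> h; rewrite inE => /orP[|/cU].
    rewrite inE => /eqP->; case: g gU up => [n|f'|f' g'|f'] gU up //; try exact: up.
    by case/andP: gU => /up-> /up->.
  case: h => [n|f'|f' g'|f'] //; try exact: up.
  by case/andP=> /up-> /up->.
elim: f => [n|f [U cU fU]|f [U cU fU] g [V cV gV]|f [U cU fU]].
- by apply: (top _ fset0) => // g; rewrite inE.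
- exact: (top _ U).
- by apply: (top _ _ (subformula_closedU cU cV)); rewrite !inE fU gV orbT.
- exact: (top _ U).
Qed.

(** Supplies the finite stock of formulas that bounds saturation. *)
Lemma subformula_closed_cover (X : {fset form}) :
  exists2 U, subformula_closed U & X `<=` U.
Proof.
apply: (fset_grow_ind (P := fun X => exists2 U, subformula_closed U & X `<=` U))
  (fsub0set X) _ _; last by exists fset0 => // f; rewrite inE.
move=> f Z _ _ [U cU sZU]; have [V cV fV] := subformula_closed1 f.
exists (U `|` V); first exact: subformula_closedU.
rewrite fsubUset fsub1set inE fV orbT /=.
exact: fsubset_trans sZU (fsubsetUl _ _).
Qed.

Lemma ex_min (T : Type) (P : T -> Prop) (m : T -> nat) x :
  P x -> exists2 y, P y & forall z, P z -> m y <= m z.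
Proof.
have [n] := ubnP (m x); elim: n x => // n IHn x ltx Px.
have [[y Py lty]|min_x] := classic (exists2 y, P y & m y < m x).
  exact: IHn (leq_trans lty ltx) Py.
exists x => // z Pz; rewrite leqNgt; apply/negP=> ltz.
by apply: min_x; exists z.
Qed.

(** Take an underivable extension within a finite subformula-closed [U] that misses the fewest
    formulas of [U]. If a saturation condition failed, a rule read backwards would add a formula and
    contradict minimality. The prefix varies too, since the reflexive box step lengthens it. *)
Lemma saturate G S H :
  ~ derivable (G ++ S :: H) ->
  exists G' S',
    [/\ ~ derivable (G' ++ S' :: H), sub_sequent S S' & saturated S'].
Proof.
move=> ndS; have [U cU] := subformula_closed_cover (ante S `|` succ S).
rewrite fsubUset => /andP[saU ssU].
pose P (x : hypersequent * sequent) :=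
  [/\ ~ derivable (x.1 ++ x.2 :: H), sub_sequent S x.2
    & sub_sequent x.2 (U ⇒ U)].
pose m (x : hypersequent * sequent) :=
  (#|` U `\` ante x.2| + #|` U `\` succ x.2|)%N.
have [] := @ex_min _ P m (G, S); first by split.
case=> G' [A B] [/= nd sS [/= sA sB]] min_m.
have shrink (f : form) (X : {fset form}) : f \in U -> f \notin X ->
    #|` U `\` (f |` X)| < #|` U `\` X|.
  move=> fU fX; have -> : U `\` (f |` X) = (U `\` X) `\ f.
    by apply/fsetP=> x; rewrite !inE negb_or andbA.
  by rewrite [X in _ < X](cardfsD1 f) inE fX fU.
have addl G2 f : f \in U -> ~ derivable (G2 ++ (f |` A ⇒ B) :: H) -> f \in A.
  move=> fU nd2; case: (boolP (f \in A)) => // /(shrink _ _ fU) lt.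
  have /min_m : P (G2, f |` A ⇒ B).
    split=> //; last by split; rewrite //= fsubUset fsub1set fU.
    by apply: sub_sequent_trans sS _; split; rewrite //= fsubsetUr.
  by rewrite /m /= leq_add2r leqNgt lt.
have addr f : f \in U -> ~ derivable (G' ++ (A ⇒ f |` B) :: H) -> f \in B.
  move=> fU nd2; case: (boolP (f \in B)) => // /(shrink _ _ fU) lt.
  have /min_m : P (G', A ⇒ f |` B).
    split=> //; last by split; rewrite //= fsubUset fsub1set fU.
    by apply: sub_sequent_trans sS _; split; rewrite //= fsubsetUr.
  by rewrite /m /= leq_add2l leqNgt lt.
have inU f : f \in A \/ f \in B -> f \in U by case; apply: fsubsetP.
(* Sides are sets, so the principal formula may stay in the premise: reading a rule backwards loses
   nothing. *)
have absorb (f : form) (X : {fset form}) : f \in X -> f |` X = X.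
  by move=> fX; apply/fsetUidPr; rewrite fsub1set.
exists G', (A ⇒ B); split=> //; split=> /=.
- move=> f fA; apply: addr; first exact: (cU _ (inU _ (or_introl fA))).
  by case=> d cd; apply: nd; rewrite -(absorb _ _ fA); exists (Neg_L d).
- move=> f fB; apply: (addl G'); first exact: (cU _ (inU _ (or_intror fB))).
  by case=> d cd; apply: nd; rewrite -(absorb _ _ fB); exists (Neg_R d).
- move=> f g fgA; have /andP[fU gU] := cU _ (inU _ (or_introl fgA)).
  split; apply: (addl G') => // -[d cd]; apply: nd; rewrite -(absorb _ _ fgA).
    by exists (And_L1 g d).
  by exists (And_L2 f d).
- move=> f g fgB; have /andP[fU gU] := cU _ (inU _ (or_intror fgB)).
  have [fB|nf] := classic (f \in B); [by left | right].
  apply: (addr g) => // -[d cd]; apply: nf; apply: addr => // -[e ce].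
  by apply: nd; rewrite -(absorb _ _ fgB); exists (And_R e d).
- move=> f fA; have fU := cU _ (inU _ (or_introl fA)).
  (* The old copy joins the prefix. [Box_L] would move [f] from the new copy into [Box f] of the old
     one, leaving two equal components for EC to merge. *)
  apply: (addl (rcons G' (A ⇒ B))) => //; rewrite cat_rcons => -[d cd]; apply: nd.
  have [e ce] : derivable (G' ++ [:: A ⇒ B, A ⇒ B & H]).
    by rewrite -{1}(absorb _ _ fA); exists (Box_L d).
  by exists (Ext (EC_rule G' H A B) e).
Qed.

(** * Chains of worlds *)

Definition sees (S T : sequent) : Prop :=
  forall f, Box f \in ante S -> f \in ante T.

Lemma sees_sub S T T' : sees S T -> sub_sequent T T' -> sees S T'.
Proof. by move=> ST [/fsubsetP sT _] f /ST /sT. Qed.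

(** As [Box f] already lies in [S], [Box_L] deletes [f] from the next component without changing
    [S]; hence adding [f] there keeps underivability. *)
Lemma push_boxes G S T H :
  ~ derivable (G ++ [:: S, T & H]) ->
  exists T', [/\ ~ derivable (G ++ [:: S, T' & H]), sub_sequent T T' & sees S T'].
Proof.
case: S T => [A B] [C D] nd.
pose unbox (f : form) := if f is Box g then Some g else None.
have in_unboxE f : (f \in pmap unbox A) = (Box f \in A).
  rewrite mem_pmap; apply/mapP/idP => [[[] //= g gA [->]] //|fA].
  by exists (Box f).
pose C' := C `|` seq_fset tt (pmap unbox A).
exists (C' ⇒ D); split; last 1 first.
- by move=> f /= fA; rewrite inE seq_fsetE in_unboxE fA orbT.
- apply: (fset_grow_ind
      (P := fun Z => ~ derivable (G ++ [:: A ⇒ B, Z ⇒ D & H]))) nd.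
    exact: fsubsetUl.
  move=> f Z; rewrite inE seq_fsetE in_unboxE => /orP[-> //|fA] _ ndZ [d cd].
  apply: ndZ; rewrite -(_ : Box f |` A = A); first by exists (Box_L d).
  by apply/fsetUidPr; rewrite fsub1set.
- by split=> //=; apply: fsubsetUl.
Qed.

Record canonical_world := CanonicalWorld {
  prefix : hypersequent;
  component : sequent;
  component_saturated : saturated component;
  canonical_underivable : ~ derivable (rcons prefix component)
}.

(** Works from left to right: saturate the first component, push its boxes into the next, move it to
    the prefix and recurse. Later steps only enlarge the next component, so [sees] survives. *)
Lemma realize G S H :
  ~ derivable (G ++ S :: H) ->
  exists w : nat -> canonical_world,
    (forall i, i < size H -> sees (component (w i)) (component (w i.+1))) /\
    (forall i, i <= size H -> sub_sequent (nth S (S :: H) i) (component (w i))).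
Proof.
elim: H G S => [|T H IH] G S /saturate[G' [S' [nd sS satS']]].
  exists (fun=> CanonicalWorld satS' (underivable_init nd)); split=> // i.
  by rewrite leqn0 => /eqP->.
have [T' [ndT' sT seesT']] := push_boxes nd.
have [w [sees_w sub_w]] : exists w : nat -> canonical_world,
    (forall i, i < size H -> sees (component (w i)) (component (w i.+1))) /\
    (forall i, i <= size H -> sub_sequent (nth T' (T' :: H) i) (component (w i))).
  by apply: (IH (rcons G' S')); rewrite cat_rcons.
exists (fun i => if i is j.+1 then w j
                 else CanonicalWorld satS' (underivable_init nd)).
split=> [[_|i]|[_|[_|i]]] //=.
- exact: sees_sub seesT' (sub_w 0 (leq0n _)).
- exact: sees_w.
- exact: sub_sequent_trans sT (sub_w 0 (leq0n _)).
(* The two [nth] terms differ in their default only, and the index is in range. *)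
- move=> lti; have := sub_w i.+1 lti.
  by rewrite /= (set_nth_default T').
Qed.

(** * The canonical model *)

Definition canonical_frame (w : canonical_world) : frame :=
  Frame (fun u v => sees (component u) (component v)) (inhabits w).

Definition canonical_model (w : canonical_world) : model :=
  @Model (canonical_frame w) (fun n u => Var n \in ante (component u)).

Lemma canonical_reflexive w : reflexive_frame (canonical_model w).
Proof. by move=> u f; apply: sat_boxl (component_saturated u) f. Qed.

(** [Box_R] acts on the rightmost component, which is why a world has nothing after its component:
    appending [⇒ f] keeps it underivable. *)
Lemma canonical_box_witness (u : canonical_world) f :
  Box f \in succ (component u) ->
  exists2 v, sees (component u) (component v) & f \in succ (component v).
Proof.
case: u => G [A B] satS nd /= fB.
have : ~ derivable (G ++ [:: A ⇒ B; fset0 ⇒ [fset f]]).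
  case=> d cd; apply: nd; rewrite -cats1 -(_ : Box f |` B = B).
    by exists (Box_R d).
  by apply/fsetUidPr; rewrite fsub1set.
case/push_boxes => T [ndT [_ sT] seesT].
(* With nothing to the right, [realize] just saturates [T] into the world [w 0]. *)
have [|w [_ /(_ 0 isT)/= sub_w]] := @realize (rcons G (A ⇒ B)) T [::].
  by rewrite cat_rcons.
exists (w 0); first exact: sees_sub seesT sub_w.
by apply: (fsubsetP sub_w.2); apply: (fsubsetP sT); rewrite /= inE.
Qed.

(** Two implications instead of an equivalence: a saturated component need not decide every
    formula. *)
Lemma canonical_truth w f (u : canonical_model w) :
  (f \in ante (component u) -> truth u f) /\
  (f \in succ (component u) -> ~ truth u f).
Proof.
elim: f u => [n|f IHf|f IHf g IHg|f IHf] u /=;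
  have sat := component_saturated u.
- split=> // us ua; apply: (@canonical_underivable u).
  by rewrite -cats1; apply: derivable_ax ua us.
- split=> [/(sat_negl sat)|/(sat_negr sat)]; case: (IHf u) => ua us.
    exact: us.
  by move=> /ua tf; apply.
- split=> [/(sat_andl sat)[/(IHf u).1 ? /(IHg u).1 ?] //|].
  by case/(sat_andr sat) => [/(IHf u).2|/(IHg u).2] nt [].
- split=> [fa v uv|/canonical_box_witness[v uv fs]].
    by apply: (IHf v).1; apply: uv.
  by move/(_ v uv); apply: (IHf v).2.
Qed.

Lemma canonical_countermodel w S (u : canonical_model w) :
  sub_sequent S (component u) -> countermodel u S.
Proof.
move=> [/fsubsetP sa /fsubsetP ss].
by split=> f; [move/sa/(canonical_truth f u).1 | move/ss/(canonical_truth f u).2].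
Qed.

Theorem mainTheorem2 (H : hypersequent) (H_nonempty : H <> [::])
  (H_valid : forall M : model, reflexive_frame M -> ~ counterexample M H) :
  exists d : RT H, cut_free d.
Proof.
case: H H_nonempty H_valid => // S H _ valid; apply: NNPP => nd.
have [w [sees_w sub_w]] := @realize [::] S H nd.
apply: (valid _ (@canonical_reflexive (w 0))).
exists (fun i => w i); split=> [i j /= ij|i].
  (* As [j = i.+1] indexes [S :: H], [i] is below [size H]. *)
  by rewrite ij; apply: sees_w; rewrite -ltnS -ij ltn_ord.
apply: canonical_countermodel; rewrite (tnth_nth S).
by apply: sub_w; rewrite -ltnS.
Qed.
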